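(* Let $(H,\alpha)$ be a finite-dimensional quasitriangular monoidal Hom-Hopf algebra over a field $k$ with quasitriangular structure $R\in H\otimes H$. Then $R$ satisfies the quantum Hom-Yang-Baxter equations $$R^{12}(R^{13}R^{23})=(R^{23}R^{13})R^{12},\qquad (R^{12}R^{13})R^{23}=R^{23}(R^{13}R^{12})$$ in $H\otimes H\otimes H$.
   Context: All vector spaces, tensor products and linear maps are over a fixed field $k$; Sweedler notation $\Delta(c)=\sum c_1\otimes c_2$ is used. Monoidal Hom-algebra $(A,\alpha)$: a vector space $A$ with a linear automorphism $\alpha$, a linear multiplication $a\otimes b\mapsto ab$ and an element $1_A$ with $\alpha(a)(bc)=(ab)\alpha(c)$, $a1_A=\alpha(a)=1_Aa$, $\alpha(ab)=\alpha(a)\alpha(b)$, $\alpha(1_A)=1_A$. Monoidal Hom-coalgebra $(C,\gamma)$: a vector space $C$ with a linear automorphism $\gamma$ and linear maps $\Delta:C\to C\otimes C$, $\varepsilon:C\to k$ with $\sum\gamma^{-1}(c_1)\otimes\Delta(c_2)=\sum\Delta(c_1)\otimes\gamma^{-1}(c_2)$, $\sum c_1\varepsilon(c_2)=\sum\varepsilon(c_1)c_2=\gamma^{-1}(c)$, $\Delta(\gamma(c))=\sum\gamma(c_1)\otimes\gamma(c_2)$, $\varepsilon(\gamma(c))=\varepsilon(c)$. Monoidal Hom-bialgebra: $(H,\alpha)$ which is both a monoidal Hom-algebra and a monoidal Hom-coalgebra (same $\alpha$), with $\Delta$ and $\varepsilon$ multiplicative and unital (componentwise product on $H\otimes H$).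 Monoidal Hom-Hopf algebra: a monoidal Hom-bialgebra with a linear map $S:H\to H$ (antipode) such that $S\alpha=\alpha S$ and $\sum S(h_1)h_2=\varepsilon(h)1=\sum h_1S(h_2)$. Quasitriangular monoidal Hom-Hopf algebra: a monoidal Hom-Hopf algebra $(H,\alpha)$ with an element $R=\sum R^{(1)}\otimes R^{(2)}\in H\otimes H$ satisfying (1) $(\varepsilon\otimes id)R=(id\otimes\varepsilon)R=1$; (2) $\Delta^{op}(x)R=R\Delta(x)$ for all $x\in H$, where $\Delta^{op}(x)=\sum x_2\otimes x_1$; (3) $(\Delta\otimes\alpha^{-1})R=R^{13}R^{23}$; (4) $(\alpha^{-1}\otimes\Delta)R=R^{13}R^{12}$. Here $R^{12}=\sum R^{(1)}\otimes R^{(2)}\otimes1$, $R^{13}=\sum R^{(1)}\otimes1\otimes R^{(2)}$, $R^{23}=\sum1\otimes R^{(1)}\otimes R^{(2)}$ in $H\otimes H\otimes H$ with componentwise product. *)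

(* Defs.v *)
From HB Require Import structures.
From mathcomp Require Import all_boot all_order all_algebra.

Set Implicit Arguments.
Unset Strict Implicit.
Unset Printing Implicit Defensive.

Import GRing.Theory.
Local Open Scope ring_scope.

(* Tensor products of finite-dimensional vector spaces.                       *)
(* U \otimes V is the space of matrices of coordinates with respect to the    *)
(* bases e_i *t f_j, where (e_i) and (f_j) are the library's chosen bases of  *)
(* U and V. The lemmas tlift_tpure and tens_ext below are its universal       *)
(* property, which determines it up to a unique isomorphism.                  *)

Definition tens (k : fieldType) (U V : vectType k) : vectType k :=
  'M[k]_(\dim {:U}, \dim {:V}).

Notation "U \otimes V" := (tens U V) (at level 40, left associativity).

Definition tpure (k : fieldType) (U V : vectType k) (u : U) (v : V) :
    U \otimes V :=
  \matrix_(i, j) (coord (vbasis {:U}) i u * coord (vbasis {:V}) j v).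

Notation "u *t v" := (tpure u v) (at level 40, left associativity).

(* The linear map on U \otimes V induced by f. As with linfun, the value is   *)
(* meaningful only if f is bilinear; only f e_i f_j is used.                  *)
Definition tlift (k : fieldType) (U V W : vectType k) (f : U -> V -> W) :
    'Hom(U \otimes V, W) :=
  linfun (fun M : 'M[k]_(\dim {:U}, \dim {:V}) =>
    \sum_i \sum_j M i j *: f (vbasis {:U})`_i (vbasis {:V})`_j).

Section TensorTheory.
Variable k : fieldType.
Implicit Types U V W : vectType k.

Local Notation is_bilinear f := (bilinear_for *:%R *:%R f).

Lemma tpure_bilinear U V : is_bilinear (@tpure k U V).
Proof.
split=> [v a u u'|u a v v']; apply/matrixP=> i j;
  rewrite !mxE linearP /=.
  by rewrite mulrDl mulrA.
by rewrite mulrDr mulrCA.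
Qed.

Lemma tlift_sum U V W (f : U -> V -> W) (x : 'M[k]_(\dim {:U}, \dim {:V})) :
  tlift f x = \sum_i \sum_j x i j *: f (vbasis {:U})`_i (vbasis {:V})`_j.
Proof.
pose g (M : 'M[k]_(\dim {:U}, \dim {:V})) :=
  \sum_i \sum_j M i j *: f (vbasis {:U})`_i (vbasis {:V})`_j.
have gL : linear g.
  move=> a M N; rewrite /g scaler_sumr -big_split; apply: eq_bigr => i _ /=.
  rewrite scaler_sumr -big_split; apply: eq_bigr => j _ /=.
  by rewrite !mxE scalerDl scalerA.
pose gm := GRing.isLinear.Build k _ W _ g gL.
pose G : {linear 'M[k]_(\dim {:U}, \dim {:V}) -> W} := HB.pack g gm.
exact: (lfunE G x).
Qed.

Lemma tlift_tpure U V W (f : U -> V -> W) u v :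
  is_bilinear f -> tlift f (u *t v) = f u v.
Proof.
move=> [fl fr].
pose fLm w := GRing.isLinear.Build k U W _ (f^~ w) (fl w).
pose fL w : {linear U -> W} := HB.pack (f^~ w) (fLm w).
pose fRm w := GRing.isLinear.Build k V W _ (f w) (fr w).
pose fR w : {linear V -> W} := HB.pack (f w) (fRm w).
have fu w : f u w = \sum_i coord (vbasis {:U}) i u *: f (vbasis {:U})`_i w.
  rewrite -[LHS]/(fL w u) [in LHS](coord_vbasis (memvf u)) linear_sum.
  by apply: eq_bigr => i _; rewrite linearZ.
rewrite tlift_sum fu; apply: eq_bigr => i _.
rewrite -[f _ v]/(fR _ v) [in RHS](coord_vbasis (memvf v)) linear_sum.
by rewrite scaler_sumr; apply: eq_bigr => j _; rewrite linearZ scalerA mxE.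
Qed.

Lemma tens_sum U V (x : U \otimes V) :
  x = \sum_i \sum_j (x : 'M[k]_(_, _)) i j *:
        ((vbasis {:U})`_i *t (vbasis {:V})`_j).
Proof.
have fU := basis_free (vbasisP {:U}); have fV := basis_free (vbasisP {:V}).
rewrite [LHS]matrix_sum_delta; apply: eq_bigr => i _; apply: eq_bigr => j _.
congr (_ *: _); apply/matrixP=> i' j'.
by rewrite !mxE !coord_free // -natrM mulnb (eq_sym i') (eq_sym j').
Qed.

Lemma tens_ext U V W (f g : 'Hom(U \otimes V, W)) :
  (forall u v, f (u *t v) = g (u *t v)) -> f = g.
Proof.
move=> fg; apply/lfunP=> x; rewrite (tens_sum x) !linear_sum.
apply: eq_bigr => i _; rewrite !linear_sum; apply: eq_bigr => j _.
by rewrite !linearZ /= fg.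
Qed.

(* On bijective endomorphisms, the library's one-sided inverse f^-1 is        *)
(* two-sided.                                                                 *)
Lemma inv_lfun_bij U (f : 'End(U)) :
  bijective f -> cancel f (f^-1)%VF /\ cancel (f^-1)%VF f.
Proof.
move=> /bij_inj f_inj; have f0 : lker f == 0%VS by apply/lker0P.
by split; [exact: lker0_lfunK | exact: lker0_lfunVK].
Qed.

Definition tmap U V U' V' (f : 'Hom(U, U')) (g : 'Hom(V, V')) :
    'Hom(U \otimes V, U' \otimes V') :=
  tlift (fun u v => f u *t g v).

Definition tswap U V : 'Hom(U \otimes V, V \otimes U) :=
  tlift (fun u v => v *t u).

Definition tassoc U V W : 'Hom(U \otimes V \otimes W, U \otimes (V \otimes W)) :=
  tlift (fun x w => tlift (fun u v => u *t (v *t w)) x).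

Definition tmul U V (mU : 'Hom(U \otimes U, U)) (mV : 'Hom(V \otimes V, V)) :
    'Hom((U \otimes V) \otimes (U \otimes V), U \otimes V) :=
  tlift (fun x y => tlift (fun a b =>
    tlift (fun a' b' => mU (a *t a') *t mV (b *t b')) y) x).

Lemma tpureDl U V (a : k) (u u' : U) (v : V) :
  (a *: u + u') *t v = a *: (u *t v) + u' *t v.
Proof. by have [/(_ v)-> _] := @tpure_bilinear U V. Qed.

Lemma tpureDr U V (a : k) (u : U) (v v' : V) :
  u *t (a *: v + v') = a *: (u *t v) + u *t v'.
Proof. by have [_ /(_ u)->] := @tpure_bilinear U V. Qed.

Lemma tmapE U V U' V' (f : 'Hom(U, U')) (g : 'Hom(V, V')) u v :
  tmap f g (u *t v) = f u *t g v.
Proof.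
rewrite tlift_tpure //; split=> [{}v a u1 u2|{}u a v1 v2];
  by rewrite linearP /= ?tpureDl ?tpureDr.
Qed.

Lemma tswapE U V (u : U) (v : V) : tswap U V (u *t v) = v *t u.
Proof.
rewrite tlift_tpure //; split=> [{}v a u1 u2|{}u a v1 v2];
  by rewrite ?tpureDl ?tpureDr.
Qed.

Lemma tlift_linear U V W (a : k) (F G G' : U -> V -> W) x :
    (forall u v, F u v = a *: G u v + G' u v) ->
  tlift F x = a *: tlift G x + tlift G' x.
Proof.
move=> FE; rewrite !tlift_sum scaler_sumr -big_split; apply: eq_bigr => i _ /=.
rewrite scaler_sumr -big_split; apply: eq_bigr => j _ /=.
by rewrite FE scalerDr !scalerA mulrC.
Qed.

Lemma tlift_bilinear U V W W' (F : W -> U -> V -> W') :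
    (forall u v, linear (fun w => F w u v)) ->
  is_bilinear (fun (x : U \otimes V) (w : W) => tlift (F w) x).
Proof.
move=> FL; split=> [w|x] a y z; first exact: linearP.
by apply: tlift_linear => u v; exact: FL.
Qed.

Lemma tassocE U V W (u : U) (v : V) (w : W) :
  tassoc U V W (u *t v *t w) = u *t (v *t w).
Proof.
rewrite tlift_tpure; last first.
  by apply: tlift_bilinear => {}u {}v a w1 w2; rewrite !tpureDr.
rewrite tlift_tpure //; split=> [{}v a u1 u2|{}u a v1 v2];
  by rewrite !(tpureDl, tpureDr).
Qed.

Lemma tmulE U V (mU : 'Hom(U \otimes U, U)) (mV : 'Hom(V \otimes V, V))
    a b a' b' :
  tmul mU mV ((a *t b) *t (a' *t b')) = mU (a *t a') *t mV (b *t b').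
Proof.
rewrite tlift_tpure; last first.
  by apply: tlift_bilinear => u v c y1 y2; exact: linearP.
rewrite tlift_tpure; last first.
  by split=> [v|u] c x y; apply: tlift_linear => u' v';
    rewrite !(tpureDl, tpureDr, linearP).
rewrite tlift_tpure //; split=> [v|u] c x y;
  by rewrite !(tpureDl, tpureDr, linearP).
Qed.

End TensorTheory.

Section HomStructures.
Variables (k : fieldType) (V : vectType k) (alpha : 'End(V)).

Record homAlgebra := HomAlgebra {
  hmul : 'Hom(V \otimes V, V);
  hone : V;
  halg_bij : bijective alpha;
  hmulA : forall a b c,
    hmul (alpha a *t hmul (b *t c)) = hmul (hmul (a *t b) *t alpha c);
  hmulr1 : forall a, hmul (a *t hone) = alpha a;
  hmul1r : forall a, hmul (hone *t a) = alpha a;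
  hmulM : forall a b, alpha (hmul (a *t b)) = hmul (alpha a *t alpha b);
  hone_fix : alpha hone = hone
}.

(* Scalar multiplication identifies k \otimes V and V \otimes k with V.       *)
Record homCoalgebra := HomCoalgebra {
  hcomul : 'Hom(V, V \otimes V);
  hcounit : 'Hom(V, k^o);
  hcoalg_bij : bijective alpha;
  hcomulA : forall c,
    tmap (alpha^-1)%VF hcomul (hcomul c) =
    tassoc V V V (tmap hcomul (alpha^-1)%VF (hcomul c));
  hcounitr : forall c,
    tlift (fun c1 c2 => hcounit c2 *: c1) (hcomul c) = (alpha^-1)%VF c;
  hcounitl : forall c,
    tlift (fun c1 c2 => hcounit c1 *: c2) (hcomul c) = (alpha^-1)%VF c;
  hcomulM : forall c, hcomul (alpha c) = tmap alpha alpha (hcomul c);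
  hcounitM : forall c, hcounit (alpha c) = hcounit c
}.

Definition hmul2 (A : homAlgebra) (x y : V \otimes V) : V \otimes V :=
  tmul (hmul A) (hmul A) (x *t y).

Definition hmul3 (A : homAlgebra) (x y : V \otimes V \otimes V) :
    V \otimes V \otimes V :=
  tmul (tmul (hmul A) (hmul A)) (hmul A) (x *t y).

Record homBialgebra := HomBialgebra {
  hbialg_alg :> homAlgebra;
  hbialg_coalg :> homCoalgebra;
  hcomul_mul : forall a b,
    hcomul hbialg_coalg (hmul hbialg_alg (a *t b)) =
    hmul2 hbialg_alg (hcomul hbialg_coalg a) (hcomul hbialg_coalg b);
  hcomul_one :
    hcomul hbialg_coalg (hone hbialg_alg) = hone hbialg_alg *t hone hbialg_alg;
  hcounit_mul : forall a b,
    hcounit hbialg_coalg (hmul hbialg_alg (a *t b)) =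
    hcounit hbialg_coalg a * hcounit hbialg_coalg b;
  hcounit_one : hcounit hbialg_coalg (hone hbialg_alg) = 1
}.

Record homHopfAlgebra := HomHopfAlgebra {
  hhopf_bialg :> homBialgebra;
  hantipode : 'End(V);
  hantipode_comm : forall h, hantipode (alpha h) = alpha (hantipode h);
  hantipodel : forall h,
    hmul hhopf_bialg (tmap hantipode \1%VF (hcomul hhopf_bialg h)) =
    hcounit hhopf_bialg h *: hone hhopf_bialg;
  hantipoder : forall h,
    hmul hhopf_bialg (tmap \1%VF hantipode (hcomul hhopf_bialg h)) =
    hcounit hhopf_bialg h *: hone hhopf_bialg
}.

Definition R12 (A : homAlgebra) (R : V \otimes V) : V \otimes V \otimes V :=
  tlift (fun r1 r2 => r1 *t r2 *t hone A) R.

Definition R13 (A : homAlgebra) (R : V \otimes V) : V \otimes V \otimes V :=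
  tlift (fun r1 r2 => r1 *t hone A *t r2) R.

Definition R23 (A : homAlgebra) (R : V \otimes V) : V \otimes V \otimes V :=
  tlift (fun r1 r2 => hone A *t r1 *t r2) R.

Definition hcomul_op (C : homCoalgebra) (x : V) : V \otimes V :=
  tswap V V (hcomul C x).

(* H \otimes H \otimes H is bracketed to the left, so alpha^-1 \otimes Delta, *)
(* which lands in H \otimes (H \otimes H), is compared with tassoc of the     *)
(* product R^13 R^12.                                                         *)
Record quasitriangular (H : homHopfAlgebra) (R : V \otimes V) : Prop :=
  Quasitriangular {
  qt_counitl : tlift (fun r1 r2 => hcounit H r1 *: r2) R = hone H;
  qt_counitr : tlift (fun r1 r2 => hcounit H r2 *: r1) R = hone H;
  qt_comul_op : forall x,
    hmul2 H (hcomul_op H x) R = hmul2 H R (hcomul H x);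
  qt_comull :
    tmap (hcomul H) (alpha^-1)%VF R = hmul3 H (R13 H R) (R23 H R);
  qt_comulr :
    tmap (alpha^-1)%VF (hcomul H) R =
    tassoc V V V (hmul3 H (R13 H R) (R12 H R))
}.

End HomStructures.

(* Main.v *)
Require Import Defs.
From mathcomp Require Import all_boot all_order all_algebra.

(** By the third axiom, R^12 (R^13 R^23) = (R (x) 1) (Delta (x) alpha^-1)(R),
    where the second axiom turns R Delta(x) into Delta^op(x) R; the result is
    the image of R^13 R^23 under the flip of the first two factors, times R^12.
    This flip is multiplicative and exchanges R^13 and R^23. The second equation
    is obtained in the same way from the fourth axiom and the flip of the last
    two factors, in H (x) (H (x) H). Hom-associativity is never needed, because
    1 acts as alpha and cancels the alpha^-1 of the axioms. *)

Set Implicit Arguments.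
Unset Strict Implicit.
Unset Printing Implicit Defensive.

Import GRing.Theory.
Local Open Scope ring_scope.

Section TensorMorphisms.
Variable k : fieldType.
Implicit Types U V W : vectType k.

Lemma tpure0l U V (v : V) : (0 : U) *t v = 0.
Proof.
by have := tpureDl (-1) (0 : U) 0 v; rewrite scaler0 addr0 scaleN1r addNr.
Qed.

(** Pure tensors span. The closure hypothesis has the shape of [linearP], so an equality of linear
    maps passes from pure tensors to all tensors by one rewriting. *)
Lemma tens_ind U V (P : U \otimes V -> Prop) :
    (forall u v, P (u *t v)) ->
    (forall a x y, P x -> P y -> P (a *: x + y)) ->
  forall x, P x.
Proof.
move=> Ppure Plin x.
(* Zero is itself a pure tensor. *)
have P0 : P 0 by rewrite -(tpure0l U (0 : V)).
have PD y z : P y -> P z -> P (y + z) by rewrite -{2}[y]scale1r; apply: Plin.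
rewrite (tens_sum x); apply: (big_ind P) => // i _; apply: (big_ind P) => // j _.
by rewrite -[_ *: _]addr0; apply: Plin.
Qed.

Lemma tmap_tmul U V U' V' (mU : 'Hom(U \otimes U, U)) (mV : 'Hom(V \otimes V, V))
    (mU' : 'Hom(U' \otimes U', U')) (mV' : 'Hom(V' \otimes V', V'))
    (f : 'Hom(U, U')) (g : 'Hom(V, V')) :
    (forall a b, f (mU (a *t b)) = mU' (f a *t f b)) ->
    (forall a b, g (mV (a *t b)) = mV' (g a *t g b)) ->
  forall x y, tmap f g (tmul mU mV (x *t y)) =
              tmul mU' mV' (tmap f g x *t tmap f g y).
Proof.
move=> fM gM; elim/tens_ind=> [a b|c x x' IH IH'] y; last first.
  by rewrite !(tpureDl, linearP) /= IH IH'.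
elim/tens_ind: y => [a' b'|c y y' IH IH']; last first.
  by rewrite !(tpureDr, linearP) /= IH IH'.
by rewrite tmulE !tmapE tmulE fM gM.
Qed.

Lemma tswap_tmul U V (mU : 'Hom(U \otimes U, U)) (mV : 'Hom(V \otimes V, V)) x y :
  tswap U V (tmul mU mV (x *t y)) =
  tmul mV mU (tswap U V x *t tswap U V y).
Proof.
elim/tens_ind: x => [a b|c x x' IH IH']; last first.
  by rewrite !(tpureDl, linearP) /= IH IH'.
elim/tens_ind: y => [a' b'|c y y' IH IH']; last first.
  by rewrite !(tpureDr, linearP) /= IH IH'.
by rewrite tmulE !tswapE tmulE.
Qed.

Lemma tassoc_tmul U V W (mU : 'Hom(U \otimes U, U)) (mV : 'Hom(V \otimes V, V))
    (mW : 'Hom(W \otimes W, W)) x y :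
  tassoc U V W (tmul (tmul mU mV) mW (x *t y)) =
  tmul mU (tmul mV mW) (tassoc U V W x *t tassoc U V W y).
Proof.
elim/tens_ind: x => [x c|d x x' IH IH']; last first.
  by rewrite !(tpureDl, linearP) /= IH IH'.
elim/tens_ind: x => [a b|d x x' IH IH']; last first.
  by rewrite !(tpureDl, linearP) /= IH IH'.
elim/tens_ind: y => [y c'|d y y' IH IH']; last first.
  by rewrite !(tpureDr, linearP) /= IH IH'.
elim/tens_ind: y => [a' b'|d y y' IH IH']; last first.
  by rewrite !(tpureDl, tpureDr, linearP) /= IH IH'.
by rewrite !tmulE !tassocE !tmulE.
Qed.

(** The opposite rebracketing [g] is a left inverse. Injectivity allows the second equation to be
    checked in H (x) (H (x) H), where the fourth axiom lives. *)
Lemma tassoc_inj U V W : injective (tassoc U V W).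
Proof.
pose g : 'Hom(U \otimes (V \otimes W), U \otimes V \otimes W) :=
  tlift (fun u y => tlift (fun v w => u *t v *t w) y).
have gE u v w : g (u *t (v *t w)) = u *t v *t w.
  rewrite tlift_tpure; last first.
    split=> [y|u'] a x z; last exact: linearP.
    by apply: tlift_linear => v' w'; rewrite !tpureDl.
  by rewrite tlift_tpure //; split=> [w'|v'] a x z; rewrite !(tpureDl, tpureDr).
apply: (can_inj (g := g)) => x.
elim/tens_ind: x => [x w|a x y IH IH']; last by rewrite !linearP /= IH IH'.
elim/tens_ind: x => [u v|a x y IH IH']; first by rewrite tassocE gE.
by rewrite !(tpureDl, linearP) /= IH IH'.
Qed.

End TensorMorphisms.

Section HomAlgebra.
Variables (k : fieldType) (V : vectType k) (alpha : 'End(V)).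
Variable (A : homAlgebra alpha).
Implicit Types R : V \otimes V.

Lemma R12_tpure r1 r2 : R12 A (r1 *t r2) = r1 *t r2 *t hone A.
Proof.
by rewrite /R12 tlift_tpure //; split=> [v|u] a x y; rewrite !(tpureDl, tpureDr).
Qed.

Lemma R13_tpure r1 r2 : R13 A (r1 *t r2) = r1 *t hone A *t r2.
Proof.
by rewrite /R13 tlift_tpure //; split=> [v|u] a x y; rewrite !(tpureDl, tpureDr).
Qed.

Lemma R23_tpure r1 r2 : R23 A (r1 *t r2) = hone A *t r1 *t r2.
Proof.
by rewrite /R23 tlift_tpure //; split=> [v|u] a x y; rewrite !(tpureDl, tpureDr).
Qed.

(** With R kept whole as one tensor factor, [tmulE] splits a product with R^12 into a product with R
    and a product with 1. [tassoc_R23] serves the same purpose in the other bracketing. *)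
Lemma R12E R : R12 A R = R *t hone A.
Proof.
elim/tens_ind: R => [r1 r2|a x y IH IH']; first exact: R12_tpure.
by rewrite tpureDl -IH -IH' /R12 linearP.
Qed.

Lemma tassoc_R23 R : tassoc V V V (R23 A R) = hone A *t R.
Proof.
elim/tens_ind: R => [r1 r2|a x y IH IH']; first by rewrite R23_tpure tassocE.
by rewrite tpureDr -IH -IH' /R23 !linearP.
Qed.

Lemma flip12_R13 R : tmap (tswap V V) \1%VF (R13 A R) = R23 A R.
Proof.
elim/tens_ind: R => [r1 r2|a x y IH IH'].
  by rewrite R13_tpure R23_tpure tmapE tswapE id_lfunE.
(* Linearity is visible only on the underlying [tlift]; the two folds restore [R13] at [x] and at
   [y]. *)
by rewrite /R13 /R23 !linearP /= -/(R13 A _) -/(R13 A _) IH IH'.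
Qed.

Lemma flip12_R23 R : tmap (tswap V V) \1%VF (R23 A R) = R13 A R.
Proof.
elim/tens_ind: R => [r1 r2|a x y IH IH'].
  by rewrite R13_tpure R23_tpure tmapE tswapE id_lfunE.
by rewrite /R13 /R23 !linearP /= -/(R23 A _) -/(R23 A _) IH IH'.
Qed.

(** The last two factors form a single tensor factor only after [tassoc], which is why the flip is
    applied there. *)
Lemma flip23_R12 R :
  tmap \1%VF (tswap V V) (tassoc V V V (R12 A R)) = tassoc V V V (R13 A R).
Proof.
elim/tens_ind: R => [r1 r2|a x y IH IH'].
  by rewrite R12_tpure R13_tpure !tassocE tmapE tswapE id_lfunE.
by rewrite /R12 /R13 !linearP /= -/(R12 A _) -/(R12 A _) IH IH'.
Qed.

Lemma flip23_R13 R :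
  tmap \1%VF (tswap V V) (tassoc V V V (R13 A R)) = tassoc V V V (R12 A R).
Proof.
elim/tens_ind: R => [r1 r2|a x y IH IH'].
  by rewrite R12_tpure R13_tpure !tassocE tmapE tswapE id_lfunE.
by rewrite /R12 /R13 !linearP /= -/(R13 A _) -/(R13 A _) IH IH'.
Qed.

Lemma flip12_hmul3 x y :
  tmap (tswap V V) \1%VF (hmul3 A x y) =
  hmul3 A (tmap (tswap V V) \1%VF x) (tmap (tswap V V) \1%VF y).
Proof. by apply: tmap_tmul => a b; rewrite ?tswap_tmul ?id_lfunE. Qed.

Lemma hmul1V v : hmul A (hone A *t (alpha^-1)%VF v) = v.
Proof. by rewrite hmul1r (inv_lfun_bij (halg_bij A)).2. Qed.

Lemma hmulV1 v : hmul A ((alpha^-1)%VF v *t hone A) = v.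
Proof. by rewrite hmulr1 (inv_lfun_bij (halg_bij A)).2. Qed.

End HomAlgebra.

Section Quasitriangular.
Variables (k : fieldType) (V : vectType k) (alpha : 'End(V)).
Variables (H : homHopfAlgebra alpha) (R : V \otimes V).
Hypothesis RQ : quasitriangular H R.

Local Notation m := (hmul H).

(** A tensor [Q] separate from R lets the induction decompose one occurrence of R and keep the other
    whole. For [Q = x *t y] the sides are R Delta(x) (x) y and Delta^op(x) R (x) y. *)
Lemma qt_comul_opl (Q : V \otimes V) :
  hmul3 H (R *t hone H) (tmap (hcomul H) (alpha^-1)%VF Q) =
  hmul3 H (tmap (tswap V V) \1%VF (tmap (hcomul H) (alpha^-1)%VF Q))
    (R *t hone H).
Proof.
rewrite /hmul3; elim/tens_ind: Q => [x y|a x y IH IH']; last first.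
  by rewrite !(tpureDl, tpureDr, linearP) /= IH IH'.
rewrite !tmapE !tmulE id_lfunE hmul1V hmulV1; congr (_ *t _).
by have := qt_comul_op RQ x; rewrite /hmul2 /hcomul_op => ->.
Qed.

Lemma qt_comul_opr (Q : V \otimes V) :
  tmul m (tmul m m) ((hone H *t R) *t tmap (alpha^-1)%VF (hcomul H) Q) =
  tmul m (tmul m m)
    (tmap \1%VF (tswap V V) (tmap (alpha^-1)%VF (hcomul H) Q) *t (hone H *t R)).
Proof.
elim/tens_ind: Q => [x y|a x y IH IH']; last first.
  by rewrite !(tpureDl, tpureDr, linearP) /= IH IH'.
rewrite !tmapE !tmulE id_lfunE hmul1V hmulV1; congr (_ *t _).
by have := qt_comul_op RQ y; rewrite /hmul2 /hcomul_op => ->.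
Qed.

End Quasitriangular.

Theorem proposition4p10 (k : fieldType) (V : vectType k) (alpha : 'End(V))
    (H : homHopfAlgebra alpha) (R : tens V V) :
  quasitriangular H R ->
  hmul3 H (R12 H R) (hmul3 H (R13 H R) (R23 H R)) =
    hmul3 H (hmul3 H (R23 H R) (R13 H R)) (R12 H R) /\
  hmul3 H (hmul3 H (R12 H R) (R13 H R)) (R23 H R) =
    hmul3 H (R23 H R) (hmul3 H (R13 H R) (R12 H R)).
Proof.
move=> RQ; split.
  (* The third axiom is used in both directions: before R^12 moves across, and afterwards under the
     flip. *)
  rewrite -(qt_comull RQ) R12E (qt_comul_opl RQ) (qt_comull RQ).
  by rewrite flip12_hmul3 flip12_R13 flip12_R23.
apply: tassoc_inj; rewrite /hmul3 !tassoc_tmul.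
(* The fourth axiom, with its right side as a product in H (x) (H (x) H), can then be used in both
   directions too. *)
have := qt_comulr RQ; rewrite /hmul3 tassoc_tmul => Rr.
rewrite tassoc_R23 -Rr (qt_comul_opr RQ) Rr.
rewrite (tmap_tmul (mU' := hmul H) (mV' := tmul (hmul H) (hmul H))).
- by rewrite flip23_R12 flip23_R13.
- by move=> a b; rewrite !id_lfunE.
- by move=> a b; rewrite tswap_tmul.
Qed.
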